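(* Let $\zeta_5$ be a primitive fifth root of unity. Then \[ \sum_{n=0}^\infty\sum_{m=-\infty}^\infty M2(m,n)\zeta_5^mq^n=\sum_{r=0}^4q^rM2_{r,5}(q^5), \] where \begin{align*} M2_{0,5}(q)&=\frac{(-q^3,-q^5,-q^7,q^{10};q^{10})_\infty}{(-q,q^4,q^6,-q^9;q^{10})_\infty},\qquad M2_{1,5}(q)=\frac{(-q^5,q^{10};q^{10})_\infty}{(q^2,q^8;q^{10})_\infty},\\ M2_{2,5}(q)&=(\zeta_5+\zeta_5^4)\frac{(q^2,-q^3,-q^5,-q^7,q^8,q^{10};q^{10})_\infty}{(-q,q^4,q^4,q^6,q^6,-q^9;q^{10})_\infty}-\frac{(-q,q^4,-q^5,q^6,-q^9,q^{10};q^{10})_\infty}{(q^2,q^2,-q^3,-q^7,q^8,q^8;q^{10})_\infty},\\ M2_{3,5}(q)&=(\zeta_5+\zeta_5^4)\frac{(-q^5,q^{10};q^{10})_\infty}{(q^4,q^6;q^{10})_\infty},\qquad M2_{4,5}(q)=-(\zeta_5+\zeta_5^4)\frac{(-q,-q^5,-q^9,q^{10};q^{10})_\infty}{(q^2,-q^3,-q^7,q^8;q^{10})_\infty}. \end{align*}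
   Context: $(a;q)_\infty=\prod_{k\ge0}(1-aq^k)$ and $(a_1,\dots,a_j;q)_\infty=(a_1;q)_\infty\cdots(a_j;q)_\infty$ (repeated arguments are repeated factors). The numbers $M2(m,n)$ are defined by \[ \sum_{n\ge0}\sum_mM2(m,n)z^mq^n=\frac{(-q;q^2)_\infty(q^2;q^2)_\infty}{(zq^2;q^2)_\infty(z^{-1}q^2;q^2)_\infty}. \] *)

(* Defs.v *)
From mathcomp Require Import all_boot all_order all_algebra all_field.
Set Implicit Arguments. Unset Strict Implicit. Unset Printing Implicit Defensive.
Import Order.TTheory GRing.Theory Num.Theory.
Local Open Scope ring_scope.

Section Series.
Variable R : comNzRingType.

Definition series := nat -> R.

Definition sone : series := fun n => if n == 0%N then 1 else 0.
Definition sadd (f g : series) : series := fun n => f n + g n.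
Definition sopp (f : series) : series := fun n => - f n.
Definition sscale (c : R) (f : series) : series := fun n => c * f n.
Definition smul (f g : series) : series :=
  fun n => \sum_(i < n.+1) f i * g (n - i)%N.
Definition sshift (r : nat) (f : series) : series :=
  fun n => if (r <= n)%N then f (n - r)%N else 0.
Definition sdilate (k : nat) (f : series) : series :=
  fun n => if (k %| n)%N then f (n %/ k)%N else 0.

(* (a q^o ; q^s)_oo = prod_{k>=0} (1 - a q^(o + s k)), valid for s >= 1:
   the coefficient of q^n only involves the factors k <= n. *)
Definition poch (s : nat) (a : R) (o : nat) : series :=
  fun n => (\prod_(k < n.+1) (1 - a *: 'X^(o + s * k)) : {poly R})`_n.

(* 1 / (a q^o ; q^s)_oo = prod_{k>=0} sum_{j>=0} a^j q^(j (o + s k)),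
   valid for o >= 1 (always the case below): truncation at j, k <= n. *)
Definition ipoch (s : nat) (a : R) (o : nat) : series :=
  fun n => (\prod_(k < n.+1) \sum_(j < n.+1) a ^+ j *: 'X^(j * (o + s * k))
             : {poly R})`_n.

Definition pochl (s : nat) (l : seq (R * nat)) : series :=
  \big[smul/sone]_(p <- l) poch s p.1 p.2.
Definition ipochl (s : nat) (l : seq (R * nat)) : series :=
  \big[smul/sone]_(p <- l) ipoch s p.1 p.2.
Definition qratio (s : nat) (num den : seq (R * nat)) : series :=
  smul (pochl s num) (ipochl s den).

End Series.

(* ---- The numbers M2(m,n) ----
   Coefficient ring: {poly {poly int}} with outer variable z := 'X and inner
   variable w := 'X%:P standing for z^{-1}.  The coefficient of z^m in the
   Laurent polynomial obtained by w |-> z^{-1} is the sum of the coefficients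
   of z^a w^b with a - b = m. *)
Definition ZW := {poly {poly int}}.
Definition zvar : ZW := 'X.
Definition wvar : ZW := ('X)%:P.

Definition M2gen : series ZW :=
  smul (smul (poch 2 (-1) 1) (poch 2 1 2))
       (smul (ipoch 2 zvar 2) (ipoch 2 wvar 2)).

Definition M2 (m : int) (n : nat) : int :=
  \sum_(a < size (M2gen n))
    \sum_(b < size ((M2gen n)`_a) | (a%:Z - b%:Z == m))
      ((M2gen n)`_a)`_b.

Section RHS.
Variable zeta : algC.
Let c : algC := zeta + zeta ^+ 4.
Let m1 : algC := -1.

Definition M2_05 : series algC :=
  qratio 10 [:: (m1,3%N); (m1,5%N); (m1,7%N); (1,10%N)]
            [:: (m1,1%N); (1,4%N); (1,6%N); (m1,9%N)].
Definition M2_15 : series algC :=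
  qratio 10 [:: (m1,5%N); (1,10%N)] [:: (1,2%N); (1,8%N)].
Definition M2_25 : series algC :=
  sadd (sscale c (qratio 10
          [:: (1,2%N); (m1,3%N); (m1,5%N); (m1,7%N); (1,8%N); (1,10%N)]
          [:: (m1,1%N); (1,4%N); (1,4%N); (1,6%N); (1,6%N); (m1,9%N)]))
       (sopp (qratio 10
          [:: (m1,1%N); (1,4%N); (m1,5%N); (1,6%N); (m1,9%N); (1,10%N)]
          [:: (1,2%N); (1,2%N); (m1,3%N); (m1,7%N); (1,8%N); (1,8%N)])).
Definition M2_35 : series algC :=
  sscale c (qratio 10 [:: (m1,5%N); (1,10%N)] [:: (1,4%N); (1,6%N)]).
Definition M2_45 : series algC :=
  sopp (sscale c (qratio 10 [:: (m1,1%N); (m1,5%N); (m1,9%N); (1,10%N)]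
                            [:: (1,2%N); (m1,3%N); (m1,7%N); (1,8%N)])).

Definition M2_r5 (r : nat) : series algC :=
  match r with
  | 0 => M2_05 | 1 => M2_15 | 2 => M2_25 | 3 => M2_35 | _ => M2_45
  end%N.

Definition M2rhs : series algC :=
  fun n => \sum_(r < 5) sshift r (sdilate 5 (M2_r5 r)) n.
End RHS.

(* Main.v *)
(* At z = zeta, put y = q^2 and Q = -q. The product of (y;y)_oo and the four
   (zeta^i y;y)_oo is (y^5;y^5)_oo, so the generating function times (y^5;y^5)_oo
   equals (Q;Q)_oo times (y, zeta^2 y, zeta^-2 y; y)_oo. By the Jacobi triple
   product, for a primitive fifth root of unity t,
     (q, t q, t^-1 q; q)_oo = A(q) + (t^2 + t^3) q B(q),
   with A = (q^10,q^15,q^25;q^25)_oo and B = (q^5,q^20,q^25;q^25)_oo. The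
   product of this identity at t and at t^2 is
     (q;q)_oo (q^5;q^5)_oo = A^2 - q A B - q^2 B^2,
   and the theorem is the product of these two dissections, at y and at Q.
   Coefficients are compared in R[X]/(X^N), where q is nilpotent, so that all
   infinite products and theta series are finite. *)
Require Import Defs.
From mathcomp Require Import all_boot all_order all_algebra all_field.
From mathcomp Require Import ring zify.
Import Order.TTheory GRing.Theory Num.Theory.
Local Open Scope ring_scope.
Set Implicit Arguments.
Unset Strict Implicit.

(** * Gaussian binomials and the finite Jacobi triple product *)

Section QBinomial.
Variables (A : comNzRingType) (p : A).
Implicit Types m k n : nat.

Fixpoint qbinom m k : A :=
  match m, k with
  | _, 0 => 1
  | 0, _.+1 => 0
  | m'.+1, k'.+1 => qbinom m' k' + p ^+ k'.+1 * qbinom m' k'.+1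
  end.

Lemma qbinom0 m : qbinom m 0 = 1. Proof. by case: m. Qed.

Lemma qbinomS m k :
  qbinom m.+1 k.+1 = qbinom m k + p ^+ k.+1 * qbinom m k.+1.
Proof. by []. Qed.

Lemma qbinom_small m k : (m < k)%N -> qbinom m k = 0.
Proof.
elim: m k => [|m IH] [|k] //= lt_mk.
by rewrite !IH ?mulr0 ?addr0 //; lia.
Qed.

(** The ratio of neighbouring Gaussian binomials, cross-multiplied because [1 - p ^+ k.+1] may fail
    to be invertible. *)
Lemma qbinom_step m k : (k <= m)%N ->
  (1 - p ^+ k.+1) * qbinom m k.+1 = (1 - p ^+ (m - k)) * qbinom m k.
Proof.
elim: m k => [|m IH] [|k] //= le_km.
- by rewrite mulr0 subnn expr0 subrr mul0r.
- have := IH 0%N isT; rewrite qbinom0 subn0 expr1 mulr1 => E.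
  by rewrite subn0 exprS mulr1 mulrDr mulr1 mulrCA E; ring.
move: le_km; rewrite ltnS => le_km.
have Ek := IH k le_km.
rewrite subSS (mulrDr (1 - p ^+ (m - k))) -Ek.
have -> : (1 - p ^+ k.+2) *
     (qbinom m k.+1 + p ^+ k.+2 * qbinom m k.+2) =
   (1 - p ^+ m.+1) * qbinom m k.+1.
  have [lt_km|ge_km] := ltnP k m; last first.
    by rewrite !qbinom_small ?mulr0 ?addr0 ?mulr0 //; lia.
  rewrite mulrDr mulrCA (IH k.+1 lt_km).
  have -> : m.+1 = (k.+2 + (m - k.+1))%N by lia.
  by rewrite exprD; ring.
have -> : m.+1 = (k.+1 + (m - k))%N by lia.
by rewrite exprD; ring.
Qed.

(** The two q-Pascal rules differ exactly by [qbinom_step]. *)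
Lemma qbinomSr m k : (k <= m)%N ->
  qbinom m.+1 k.+1 = p ^+ (m - k) * qbinom m k + qbinom m k.+1.
Proof.
move=> le_km; have := qbinom_step le_km; rewrite qbinomS => E.
apply: subr0_eq; rewrite -[RHS](subrr ((1 - p ^+ (m - k)) * qbinom m k)).
by rewrite -{2}E; ring.
Qed.

(** Both Pascal rules combined: the three-term recurrence matching the passage from [n.*2] to
    [n.+1.*2]. *)
Lemma qbinomSS m k : (k < m)%N ->
  qbinom m.+2 k.+2 = p ^+ (m - k) * qbinom m k
    + (1 + p ^+ m.+1) * qbinom m k.+1 + p ^+ k.+2 * qbinom m k.+2.
Proof.
move=> lt_km; rewrite qbinomS (qbinomSr (ltnW lt_km)) qbinomSr //.
have -> : m.+1 = (k.+2 + (m - k.+1))%N by lia.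
by rewrite exprD; ring.
Qed.

Definition qfact n : A := \prod_(i < n) (1 - p ^+ i.+1).

Lemma qbinom_qfact m k : (k <= m)%N ->
  qbinom m k * qfact k * qfact (m - k) = qfact m.
Proof.
elim: k => [|k IH] le_km.
  by rewrite qbinom0 {1}/qfact big_ord0 subn0 !mul1r.
rewrite -IH 1?ltnW // {1}/qfact big_ord_recr /= -/(qfact k).
have -> : (m - k = (m - k.+1).+1)%N by lia.
rewrite [qfact (_).+1]/qfact big_ord_recr /= -/(qfact _).
have -> : ((m - k.+1).+1 = m - k)%N by lia.
have := qbinom_step (ltnW le_km) => E.
transitivity ((1 - p ^+ k.+1) * qbinom m k.+1 * qfact k * qfact (m - k.+1)).
  by ring.
by rewrite E; ring.
Qed.

Variables z w : A.
Hypothesis zwp : z * w = p.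

(* [z ^ j * p ^ (j (j - 1) / 2)] for the integer [j = k - n], with negative
   powers of [z] expressed through [w = p / z]. *)
Definition theta_term n k : A :=
  if (n <= k)%N then z ^+ (k - n) * p ^+ 'C(k - n, 2)
  else w ^+ (n - k) * p ^+ 'C(n - k, 2).

Lemma theta_termS n k : theta_term n.+1 k.+1 = theta_term n k.
Proof. by rewrite /theta_term !subSS ltnS. Qed.

Lemma bin2S j : 'C(j.+1, 2) = ('C(j, 2) + j)%N.
Proof. by rewrite binS bin1. Qed.

(** With j = k - n, multiplication by [z * p ^+ j] moves the theta term from j to j + 1; the bound
    on [k] keeps the exponent of [p] that is left over nonnegative. *)
Lemma theta_term_z n k : (k <= n.*2)%N ->
  p ^+ n * z * theta_term n k = p ^+ (n.*2 - k) * theta_term n k.+1.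
Proof.
move=> le_k; rewrite /theta_term; have [le_nk|lt_kn] := leqP n k.
  rewrite leqW // subSn // bin2S exprD exprS.
  have {1}-> : n = (n.*2 - k + (k - n))%N by lia.
  by rewrite exprD; ring.
have [eq_nk|lt_nk] := leqP n k.+1.
  have -> : n = k.+1 by lia.
  rewrite subnn subSnn (_ : k.+1.*2 - k = k.+2)%N; last by lia.
  by rewrite !expr1 !expr0 !mulr1 -mulrA zwp -exprSr.
have -> : (n - k = (n - k.+1).+1)%N by lia.
rewrite bin2S exprS exprD.
have -> : (n.*2 - k = n + (n - k.+1) + 1)%N by lia.
rewrite (exprD _ _ 1) expr1 exprD.
transitivity (p ^+ n * p ^+ (n - k.+1) * (z * w) *
  (w ^+ (n - k.+1) * p ^+ 'C(n - k.+1, 2))); first by ring.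
by rewrite zwp.
Qed.

Lemma theta_term_w n k : (k <= n.*2)%N ->
  p ^+ n * w * theta_term n k = p ^+ k * theta_term n.+1 k.
Proof.
move=> le_k; rewrite /theta_term; have [le_nk|lt_kn] := leqP n k; last first.
  rewrite ltnNge ltnW //= subSn 1?ltnW // bin2S exprD exprS.
  have {1}-> : n = (k + (n - k))%N by lia.
  by rewrite exprD; ring.
have [lt_nk|le_kn] := ltnP n k.
  have -> : (k - n = (k - n.+1).+1)%N by lia.
  rewrite bin2S exprS exprD.
  have e_k : k = (n + (k - n.+1) + 1)%N by lia.
  rewrite [p ^+ k](_ : _ = p ^+ n * p ^+ (k - n.+1) * (z * w)).
    by ring.
  by rewrite zwp -exprD -exprSr -addn1 -e_k.
have -> : k = n by lia.
by rewrite subnn subSnn !expr1 !expr0 !mulr1.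
Qed.

(** Induction on [n]: the new pair of factors expands to [1 + p ^+ n.*2.+1 - p ^+ n * w - p ^+ n *
    z], whose parts shift the theta index by 0, -1 and +1. Comparing coefficients then amounts to
    [qbinomSS]. *)
Lemma finite_jacobi_triple n :
  \prod_(i < n) ((1 - z * p ^+ i) * (1 - w * p ^+ i)) =
  \sum_(k < n.*2.+1) (-1) ^+ (n + k) * qbinom n.*2 k * theta_term n k.
Proof.
elim: n => [|n IH].
  by rewrite big_ord0 big_ord_recl big_ord0 /theta_term /= !expr0 !mulr1 addr0.
rewrite big_ord_recr /= {}IH doubleS.
set m := n.*2; set E' := theta_term n.+1.
pose c k := (-1) ^+ (n + k) * qbinom m k.
have c0 k : (m < k)%N -> c k = 0 by move=> ?; rewrite /c qbinom_small ?mulr0.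
transitivity (\sum_(k < m.+1) c k * (1 + p ^+ m.+1) * E' k.+1
  - \sum_(k < m.+1) c k * p ^+ k * E' k
  - \sum_(k < m.+1) c k * p ^+ (m - k) * E' k.+2).
  rewrite big_distrl -!sumrB; apply: eq_bigr => k _ /=.
  have le_km : (k <= n.*2)%N by rewrite -ltnS.
  have Ez := theta_term_z le_km; have Ew := theta_term_w le_km.
  rewrite /E' !theta_termS -/(c k) -mulrA.
  transitivity (c k * ((1 + p ^+ n * p ^+ n * (z * w)) * theta_term n k
     - p ^+ n * w * theta_term n k - p ^+ n * z * theta_term n k)).
    by ring.
  by rewrite Ez Ew zwp -exprD -exprSr addnn -/m; ring.
(* All sums are reindexed to run over [E' k.+2], with the boundary terms at [E' 0] and [E' 1] split
   off; added top terms vanish by [c0]. *)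
have -> : \sum_(k < m.+1) c k * (1 + p ^+ m.+1) * E' k.+1 =
    c 0%N * (1 + p ^+ m.+1) * E' 1%N +
    \sum_(k < m.+1) c k.+1 * (1 + p ^+ m.+1) * E' k.+2.
  rewrite big_ord_recl; congr (_ + _).
  by rewrite [RHS]big_ord_recr /= (c0 m.+1) // !mul0r addr0.
have -> : \sum_(k < m.+1) c k * p ^+ k * E' k =
    c 0%N * E' 0%N + c 1%N * p * E' 1%N +
    \sum_(k < m.+1) c k.+2 * p ^+ k.+2 * E' k.+2.
  transitivity (\sum_(k < m.+3) c k * p ^+ k * E' k).
    rewrite [RHS]big_ord_recr [X in _ = X + _]big_ord_recr /=.
    by rewrite !c0 // !mul0r !addr0.
  rewrite 2!big_ord_recl /= expr0 expr1 mulr1 addrA; congr (_ + _).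
pose c' k := (-1) ^+ (n.+1 + k) * qbinom m.+2 k.
transitivity (c' 0%N * E' 0%N + c' 1%N * E' 1%N +
    \sum_(k < m.+1) c' k.+2 * E' k.+2); last first.
  by rewrite [RHS](big_ord_recl m.+2) (big_ord_recl m.+1) addrA.
have -> : \sum_(k < m.+1) c' k.+2 * E' k.+2 =
   \sum_(k < m.+1) (c k.+1 * (1 + p ^+ m.+1) * E' k.+2
      - c k.+2 * p ^+ k.+2 * E' k.+2 - c k * p ^+ (m - k) * E' k.+2).
  apply: eq_bigr => k _; rewrite /c'.
  have [lt_km|le_mk] := ltnP k m.
    by rewrite qbinomSS // /c !addnS !addSn !exprS; ring.
  (* [qbinomSS] does not cover the top index, where most binomials vanish. *)
  have -> : k = m :> nat by have := ltn_ord k; lia.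
  rewrite (c0 m.+1) // (c0 m.+2) // subnn expr0 !mul0r subrr sub0r mulr1.
  rewrite qbinomS qbinomSr // subnn expr0 mul1r.
  rewrite (@qbinom_small m m.+1) // (@qbinom_small m.+1 m.+2) //.
  by rewrite /c !addnS !addSn !exprS; ring.
have E1 : qbinom m.+2 1 = 1 + p ^+ m.+1 + p * qbinom m 1.
  rewrite (@qbinomSr m.+1 0) // subn0 qbinom0 (qbinomS m 0) qbinom0 expr1.
  by ring.
by rewrite !sumrB /c /c' E1 !qbinom0 !addn0 !addn1 !exprS; ring.
Qed.
End QBinomial.

(** * Infinite products and theta series at a nilpotent base *)

Section NilpotentPochhammer.
Variables (A : comNzRingType) (N : nat).
Implicit Types p q x z w a : A.

(** When [p ^+ N = 0] every later factor is 1, so this is the full product (a;p)_oo. *)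
Definition npoch p a : A := \prod_(k < N) (1 - a * p ^+ k).

Lemma expr_nil p m : p ^+ N = 0 -> (N <= m)%N -> p ^+ m = 0.
Proof. by move=> pN le_Nm; rewrite -(subnK le_Nm) exprD pN mulr0. Qed.

Lemma npoch_widen p a M : p ^+ N = 0 -> (N <= M)%N ->
  \prod_(k < M) (1 - a * p ^+ k) = npoch p a.
Proof.
move=> pN le_NM; rewrite -(subnKC le_NM) big_split_ord /=.
rewrite [X in _ * X]big1 ?mulr1 // => i _.
by rewrite (expr_nil pN) ?leq_addr // mulr0 subr0.
Qed.

Lemma npochS p a : p ^+ N = 0 -> npoch p a = (1 - a) * npoch p (a * p).
Proof.
move=> pN; rewrite -(npoch_widen a pN (leqnSn N)) big_ord_recl expr0 mulr1.
by congr (_ * _); apply: eq_bigr => i _; rewrite /= exprS mulrA.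
Qed.

Lemma big_residues (T : Type) (idx : T) (op : Monoid.com_law idx)
    (F : nat -> T) m M :
  \big[op/idx]_(k < M * m) F k =
  \big[op/idx]_(r < m) \big[op/idx]_(k < M) F (m * k + r)%N.
Proof.
elim: M => [|M IH]; first by rewrite big_ord0 big1 // => r _; rewrite big_ord0.
rewrite mulSn addnC big_split_ord /= IH -big_split; apply: eq_bigr => r _ /=.
by rewrite big_ord_recr /= mulnC.
Qed.

Lemma npoch_residues m p a : p ^+ N = 0 -> (0 < m)%N ->
  npoch p a = \prod_(r < m) npoch (p ^+ m) (a * p ^+ r).
Proof.
move=> pN m_gt0.
rewrite -(npoch_widen a pN (leq_pmulr N m_gt0)).
rewrite (big_residues _ (fun k => 1 - a * p ^+ k)).
apply: eq_bigr => r _; apply: eq_bigr => k _.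
by rewrite -exprM exprD mulrA mulrAC -mulrA.
Qed.

(** The terms j >= 0 of the bilateral theta series. The terms j < 0 have the same shape, with
    [w * p] for [z] and a factor [- w]. For nilpotent [p], [N.+1] terms suffice by [leq_bin2]. *)
Definition half_theta M z p : A :=
  \sum_(j < M) (-1) ^+ j * z ^+ j * p ^+ 'C(j, 2).

Lemma leq_bin2 j : (N < j)%N -> (N <= 'C(j, 2))%N.
Proof. by case: j => // j lt_Nj; rewrite bin2S (leq_trans _ (leq_addl _ _)). Qed.

Lemma half_theta_widen M z p : p ^+ N = 0 -> (N < M)%N ->
  half_theta M z p = half_theta N.+1 z p.
Proof.
move=> pN lt_NM; rewrite -(subnKC lt_NM) /half_theta big_split_ord /=.
rewrite [X in _ + X]big1 ?addr0 // => i _.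
by rewrite (expr_nil pN (leq_bin2 _)) ?mulr0 //; lia.
Qed.

Lemma qfact_npoch p M : p ^+ N = 0 -> (N <= M)%N -> qfact p M = npoch p p.
Proof.
move=> pN le_NM; rewrite -(npoch_widen p pN le_NM).
by apply: eq_bigr => i _; rewrite exprS.
Qed.


(** The inverse is existential since [A] is an arbitrary commutative ring, with no inverse
    operation. *)
Definition invertible a := exists v, v * a = 1.

Lemma invertibleM a b : invertible a -> invertible b -> invertible (a * b).
Proof.
by move=> [v va] [u ub]; exists (v * u); rewrite mulrACA va ub mulr1.
Qed.

Lemma invertibleI a x y : invertible a -> a * x = a * y -> x = y.
Proof. by move=> [v va] /(congr1 ( *%R v)); rewrite !mulrA va !mul1r. Qed.

Lemma invertible_1sub x : x ^+ N = 0 -> invertible (1 - x).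
Proof.
move=> xN; exists (\sum_(i < N) x ^+ i).
by rewrite -opprB mulrN mulrC -subrX1 xN sub0r opprK.
Qed.

Lemma invertible_prod I (r : seq I) (F : I -> A) :
  (forall i, invertible (F i)) -> invertible (\prod_(i <- r) F i).
Proof.
move=> uF; apply: big_ind => //; last exact: invertibleM.
by exists 1; rewrite mulr1.
Qed.

Lemma invertible_npoch p a : a ^+ N = 0 -> invertible (npoch p a).
Proof.
by move=> aN; apply: invertible_prod => i; apply: invertible_1sub;
  rewrite exprMn aN mul0r.
Qed.

(** The limit of a Gaussian binomial is 1/(p;p)_oo: in this range all three q-factorials of
    [qbinom_qfact] equal [npoch p p], and one of them cancels. *)
Lemma qbinom_npoch p n k : p ^+ N = 0 -> (N <= k)%N -> (k + N <= n)%N ->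
  npoch p p * qbinom p n k = 1.
Proof.
move=> pN le_Nk le_kn; apply: (invertibleI (invertible_npoch p pN)).
have le_k_n : (k <= n)%N by lia.
have := qbinom_qfact p le_k_n; rewrite !qfact_npoch //; try lia.
by move=> E; rewrite mulr1 -[RHS]E; ring.
Qed.

Lemma sum_centered n (F : nat -> A) :
  \sum_(k < n.*2.+1) F k =
  \sum_(j < n.+1) F (n + j)%N + \sum_(j < n) F (n - j.+1)%N.
Proof.
have -> : (n.*2.+1 = n + n.+1)%N by lia.
rewrite big_split_ord addrC /=; congr (_ + _).
by rewrite (reindex_inj rev_ord_inj).
Qed.

(** The finite identity for large [n]: multiplying by (p;p)_oo turns the central binomials into 1,
    and away from the centre the power of [p] vanishes. *)
Lemma jacobi_triple M p z w : p ^+ N = 0 -> (N < M)%N -> z * w = p ->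
  npoch p p * npoch p z * npoch p w =
  half_theta M z p - w * half_theta M (w * p) p.
Proof.
move=> pN lt_NM zwp; 
(* For j <= N the indices [n + j] and [n - j.+1] must both keep distance at least [N] from 0 and
   from [n.*2]. *)
have [n lt_2Nn] : exists n, (N.*2.+1 < n)%N by exists N.*2.+2.
have P1 k : (N <= k)%N -> (k + N <= n.*2)%N ->
    npoch p p * qbinom p n.*2 k = 1 by apply: qbinom_npoch.
have le_Nn : (N <= n)%N by lia.
have sgn_double k : (-1) ^+ k.*2 = 1 :> A by rewrite -signr_odd odd_double.
rewrite -mulrA -(npoch_widen z pN le_Nn) -(npoch_widen w pN le_Nn).
rewrite -big_split /= (finite_jacobi_triple zwp)
  (sum_centered n (fun k => (-1) ^+ (n + k) * qbinom p n.*2 k *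
     theta_term p z w n k)) mulrDr.
congr (_ + _).
  rewrite half_theta_widen // -(half_theta_widen (M := n.+1)) //.
  rewrite /half_theta big_distrr; apply: eq_bigr => j _ /=.
  rewrite /theta_term leq_addr addKn addnA addnn exprD sgn_double mul1r.
  have [le_jN|lt_Nj] := leqP j N; last first.
    by rewrite (expr_nil pN (leq_bin2 lt_Nj)) !mulr0.
  transitivity (npoch p p * qbinom p n.*2 (n + j) *
    ((-1) ^+ j * z ^+ j * p ^+ 'C(j, 2))); first by ring.
  by rewrite P1 ?mul1r //; lia.
rewrite half_theta_widen // -(half_theta_widen (M := n)) //; last by lia.
rewrite /half_theta !big_distrr -sumrN; apply: eq_bigr => j _ /=.
have lt_jn := ltn_ord j.
rewrite /theta_term leqNgt (_ : (n - j.+1 < n)%N) /=; last by lia.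
rewrite (_ : n - (n - j.+1) = j.+1)%N; last by lia.
rewrite (_ : n + (n - j.+1) = (n - j.+1).*2 + j.+1)%N; last by lia.
rewrite exprD sgn_double mul1r bin2S exprD exprMn 2!exprS.
have [le_jN|lt_Nj] := leqP j N; last first.
  by rewrite (expr_nil pN (leq_bin2 lt_Nj)) !(mulr0, mul0r) oppr0.
rewrite mulrA mulrCA.
transitivity (npoch p p * qbinom p n.*2 (n - j.+1) *
  - (w * ((-1) ^+ j * (w ^+ j * p ^+ j) * p ^+ 'C(j, 2)))); first by ring.
by rewrite P1 ?mul1r //; lia.
Qed.

Lemma bin2_mul5 k r :
  'C(5 * k + r, 2) = (25 * 'C(k, 2) + k * (10 + 5 * r) + 'C(r, 2))%N.
Proof.
elim: k => [|k IH]; first by rewrite muln0.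
have -> : (5 * k.+1 + r = (5 * k + r).+1.+4)%N by lia.
by rewrite !bin2S IH; lia.
Qed.

(** Splitting j = 5k + r: [bin2_mul5] gives the exponents, and the sign factors because 5 is odd. *)
Lemma half_theta_residues M z p :
  half_theta (M * 5) z p =
  \sum_(r < 5) (-1) ^+ r * z ^+ r * p ^+ 'C(r, 2) *
    half_theta M (z ^+ 5 * p ^+ (10 + 5 * r)) (p ^+ 25).
Proof.
rewrite /half_theta.
rewrite (big_residues _ (fun j => (-1) ^+ j * z ^+ j * p ^+ 'C(j, 2))).
apply: eq_bigr => r _; rewrite big_distrr; apply: eq_bigr => k _ /=.
have -> : (-1) ^+ (5 * k + r) = (-1) ^+ r * (-1) ^+ k :> A.
  by rewrite exprD exprM -(signr_odd _ 5) expr1 mulrC.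
rewrite exprMn -!exprM bin2_mul5 (mulnC k) !exprD.
by ring.
Qed.
End NilpotentPochhammer.

(** * The 5-dissections and their product *)

Section Dissection.
Variables (A : comNzRingType) (N : nat).
Implicit Types q t : A.
Local Notation npoch := (@npoch A N).

Lemma expr_nilM q m : (0 < m)%N -> q ^+ N = 0 -> (q ^+ m) ^+ N = 0.
Proof. by move=> m_gt0 qN; rewrite -exprM (expr_nil qN) // leq_pmull. Qed.

(** (q^a, q^b, q^25; q^25)_oo; the pairs (10, 15) and (5, 20) give A and B. *)
Definition theta25 q a b : A :=
  npoch (q ^+ 25) (q ^+ 25) * npoch (q ^+ 25) (q ^+ a) *
  npoch (q ^+ 25) (q ^+ b).

(** Multiplying by [1 - t] completes [npoch q (t * q)] to [npoch q t], so the triple product applies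
    with z = t. Its terms are sorted modulo 5 using [t ^+ 5 = 1]; the class with [t ^+ 3]
    cancels. *)
Lemma theta_root5 q t : q ^+ N = 0 -> t ^+ 5 = 1 -> invertible (1 - t) ->
  npoch q q * npoch q (t * q) * npoch q (t ^+ 4 * q) =
  theta25 q 10 15 + (t ^+ 2 + t ^+ 3) * q * theta25 q 5 20.
Proof.
move=> qN t5 inv_t; apply: (invertibleI inv_t).
have q25N : (q ^+ 25) ^+ N = 0 by apply: expr_nilM.
pose h k := half_theta N.+1 (q ^+ k) (q ^+ 25).
have thetaE a b : (a + b = 25)%N -> theta25 q a b = h a - q ^+ b * h (b + 25)%N.
  move=> ab; rewrite /theta25 (jacobi_triple q25N (ltnSn N)) -?exprD ?ab //.
have t20 : t ^+ 20 = 1 by rewrite (exprM t 5 4) t5 expr1n.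
have lt_N5 : (N < N.+1 * 5)%N by lia.
transitivity (npoch q q * npoch q t * npoch q (t ^+ 4 * q)).
  by rewrite (npochS t qN); ring.
rewrite (jacobi_triple qN lt_N5); last by rewrite mulrA -exprS t5 mul1r.
rewrite !half_theta_residues.
have -> : (t ^+ 4 * q * q) ^+ 5 = q ^+ 10.
  by transitivity (t ^+ 20 * q ^+ 10); [ring | rewrite t20 mul1r].
have -> : \sum_(r < 5) (-1) ^+ r * t ^+ r * q ^+ 'C(r, 2) *
    half_theta N.+1 (t ^+ 5 * q ^+ (10 + 5 * r)) (q ^+ 25) =
  h 10%N - t * h 15%N + t ^+ 2 * q * h 20%N - t ^+ 3 * q ^+ 3 * h 25%N
    + t ^+ 4 * q ^+ 6 * h 30%N.
  by rewrite t5 5!big_ord_recl big_ord0 /= !mul1r /h; ring.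
have -> : \sum_(r < 5) (-1) ^+ r * (t ^+ 4 * q * q) ^+ r * q ^+ 'C(r, 2) *
    half_theta N.+1 (q ^+ 10 * q ^+ (10 + 5 * r)) (q ^+ 25) =
  h 20%N - (t ^+ 4 * q * q) * h 25%N + (t ^+ 4 * q * q) ^+ 2 * q * h 30%N
    - (t ^+ 4 * q * q) ^+ 3 * q ^+ 3 * h 35%N
    + (t ^+ 4 * q * q) ^+ 4 * q ^+ 6 * h 40%N.
  by rewrite 5!big_ord_recl big_ord0 /= -!exprD /h; ring.
(* The symmetric thetas are written with swapped arguments so that [thetaE] produces the half thetas
   already present. *)
have -> : (1 - t) * (theta25 q 10 15 + (t ^+ 2 + t ^+ 3) * q * theta25 q 5 20) =
  theta25 q 10 15 - t * theta25 q 15 10 +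
   (t ^+ 2 - t ^+ 4) * q * theta25 q 20 5.
  rewrite /theta25; ring.
rewrite !thetaE //.
rewrite (_ : 15 + 25 = 40)%N // (_ : 10 + 25 = 35)%N // (_ : 5 + 25 = 30)%N //.
by ring: t5.
Qed.

(** The cyclotomic equation expresses primitivity in a ring with zero divisors; this form serves as
    a reduction rule for [ring]. *)
Lemma root5_expr4 t : t ^+ 4 + t ^+ 3 + t ^+ 2 + t + 1 = 0 ->
  t ^+ 4 = - (t ^+ 3 + t ^+ 2 + t + 1).
Proof. by move=> t_sum; apply: subr0_eq; rewrite -t_sum; ring. Qed.

Lemma root5_expr5 t : t ^+ 4 + t ^+ 3 + t ^+ 2 + t + 1 = 0 -> t ^+ 5 = 1.
Proof. by move/root5_expr4 => t4; ring: t4. Qed.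

Lemma npoch_root5 q t : q ^+ N = 0 -> t ^+ 4 + t ^+ 3 + t ^+ 2 + t + 1 = 0 ->
  npoch q q * npoch q (t * q) * npoch q (t ^+ 2 * q) * npoch q (t ^+ 3 * q) *
    npoch q (t ^+ 4 * q) = npoch (q ^+ 5) (q ^+ 5).
Proof.
move=> qN t_sum; rewrite /npoch -!big_split; apply: eq_bigr => k _ /=.
rewrite -exprM mulnC exprM; set x := q ^+ k.
have t4 := root5_expr4 t_sum.
by ring: t4.
Qed.

(* Multiplying [theta_root5] at [t] and [t ^+ 2] gives the 5-dissection of
   [(q;q)_oo] without the quintuple product identity, because
   [t ^+ 2 + t ^+ 3] and [t + t ^+ 4] have sum and product [-1]. *)
Lemma euler_dissection q t : q ^+ N = 0 ->
  t ^+ 4 + t ^+ 3 + t ^+ 2 + t + 1 = 0 ->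
  invertible (1 - t) -> invertible (1 - t ^+ 2) ->
  npoch q q * npoch (q ^+ 5) (q ^+ 5) =
  theta25 q 10 15 ^+ 2 - q * theta25 q 10 15 * theta25 q 5 20
    - q ^+ 2 * theta25 q 5 20 ^+ 2.
Proof.
move=> qN t_sum inv_t inv_t2.
have t5 := root5_expr5 t_sum.
have t4 := root5_expr4 t_sum.
have t2_5 : (t ^+ 2) ^+ 5 = 1 by rewrite exprAC t5 expr1n.
rewrite -(npoch_root5 qN t_sum).
have := theta_root5 qN t2_5 inv_t2; have := theta_root5 qN t5 inv_t.
have -> : (t ^+ 2) ^+ 4 = t ^+ 3 by ring: t5.
set a := theta25 q 10 15; set b := theta25 q 5 20 => E1 E2.
transitivity ((npoch q q * npoch q (t * q) * npoch q (t ^+ 4 * q)) *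
  (npoch q q * npoch q (t ^+ 2 * q) * npoch q (t ^+ 3 * q))); first by ring.
by rewrite E1 E2; ring: t4.
Qed.

(** (q^k; q^10)_oo with q replaced by q^5. The modulus 50 is a common refinement of the moduli 5, 10
    and 25 that occur. *)
Definition npoch50 q k : A := npoch (q ^+ 50) (q ^+ (5 * k)).

(* Everything is written in terms of [q], standing for minus the variable of
   the theorem, so that [(-q;q^2)_oo (q^2;q^2)_oo] becomes [(q;q)_oo]. *)
Lemma crank_dissection q t x y (v : nat -> A) (u := npoch50 q)
    (c := t + t ^+ 4) : q ^+ N = 0 ->
  t ^+ 4 + t ^+ 3 + t ^+ 2 + t + 1 = 0 ->
  invertible (1 - t) -> invertible (1 - t ^+ 2) ->
  x * npoch (q ^+ 2) (t * q ^+ 2) = 1 ->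
  y * npoch (q ^+ 2) (t ^+ 4 * q ^+ 2) = 1 ->
  (forall k, (0 < k)%N -> v k * u k = 1) ->
  npoch (q ^+ 2) q * npoch (q ^+ 2) (q ^+ 2) * (x * y) =
    u 3%N * u 5%N * u 7%N * u 10%N * (v 1%N * v 4%N * v 6%N * v 9%N)
  - q * (u 5%N * u 10%N * (v 2%N * v 8%N))
  + q ^+ 2 * (c * (u 2%N * u 3%N * u 5%N * u 7%N * u 8%N * u 10%N *
                   (v 1%N * v 4%N * v 4%N * v 6%N * v 6%N * v 9%N))
              - u 1%N * u 4%N * u 5%N * u 6%N * u 9%N * u 10%N *
                   (v 2%N * v 2%N * v 3%N * v 7%N * v 8%N * v 8%N))
  - q ^+ 3 * (c * (u 5%N * u 10%N * (v 4%N * v 6%N)))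
  - q ^+ 4 * (c * (u 1%N * u 5%N * u 9%N * u 10%N *
                   (v 2%N * v 3%N * v 7%N * v 8%N))).
Proof.
move=> qN t_sum inv_t inv_t2 xP yP uv.
have t5 := root5_expr5 t_sum.
have t2_5 : (t ^+ 2) ^+ 5 = 1 by rewrite exprAC t5 expr1n.
have q2N : (q ^+ 2) ^+ N = 0 by apply: expr_nilM.
have split m a b : (0 < m)%N -> (0 < a)%N -> (a * m = 10)%N ->
    npoch (q ^+ (5 * a)) (q ^+ (5 * b)) = \prod_(r < m) u (b + a * r)%N.
  move=> m0 a0 am; rewrite (npoch_residues _ (expr_nilM _ qN) m0); last by lia.
  apply: eq_bigr => r _; rewrite -!exprM -exprD /u /npoch50.
  by congr (npoch (q ^+ _) (q ^+ _)); lia.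
have P5 : npoch (q ^+ 5) (q ^+ 5) = u 1%N * u 2%N * u 3%N * u 4%N * u 5%N *
    u 6%N * u 7%N * u 8%N * u 9%N * u 10%N.
  by rewrite (split 10 1 1)%N // !big_ord_recl big_ord0 /= mulr1; ring.
have P10 : npoch ((q ^+ 2) ^+ 5) ((q ^+ 2) ^+ 5) =
    u 2%N * u 4%N * u 6%N * u 8%N * u 10%N.
  rewrite -!exprM (split 5 2 2)%N // !big_ord_recl big_ord0 /= mulr1.
  by ring.
have P25 k : npoch (q ^+ 25) (q ^+ (5 * k)) = u k * u (k + 5)%N.
  by rewrite (split 2 5 k)%N // !big_ord_recl big_ord0 /= mulr1 addn0.
have thetaE a b : theta25 q (5 * a) (5 * b) =
    u 5%N * u 10%N * (u a * u (a + 5)%N) * (u b * u (b + 5)%N).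
  by rewrite /theta25 !P25 (P25 5%N).
have theta2E a b : theta25 (q ^+ 2) (5 * a) (5 * b) =
    u 10%N * u (2 * a)%N * u (2 * b)%N.
  by rewrite /theta25 -!exprM /u /npoch50 !(mulnCA 2%N 5%N).
have := euler_dissection qN t_sum inv_t inv_t2.
rewrite P5 (thetaE 2%N 3%N) (thetaE 1%N 4%N) /= => E0.
have := theta_root5 q2N t2_5 inv_t2.
have -> : (t ^+ 2) ^+ 4 = t ^+ 3 by ring: t5.
(* Taking [t ^+ 2] for [t] turns the theta coefficient into [t ^+ 4 + t ^+ 6], which is [c]. *)
have -> : (t ^+ 2) ^+ 2 + (t ^+ 2) ^+ 3 = c by rewrite /c; ring: t5.
rewrite (theta2E 2%N 3%N) (theta2E 1%N 4%N) /= => E1.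
have := npoch_root5 q2N t_sum; rewrite P10 => E2.
have -> : npoch (q ^+ 2) q * npoch (q ^+ 2) (q ^+ 2) = npoch q q.
  rewrite (@npoch_residues _ _ 2 q q) // !big_ord_recl big_ord0 /=.
  by rewrite expr0 expr1 !mulr1 expr2.
move: E0 E1 E2 xP yP.
set E := npoch q q; set f := npoch (q ^+ 2) (q ^+ 2).
set a1 := npoch _ (t * _); set a2 := npoch _ (t ^+ 2 * _).
set a3 := npoch _ (t ^+ 3 * _); set a4 := npoch _ (t ^+ 4 * _).
move=> E0 E1 E2 xP yP.
have := uv 1%N isT; have := uv 2%N isT; have := uv 3%N isT.
have := uv 4%N isT; have := uv 5%N isT; have := uv 6%N isT.
have := uv 7%N isT; have := uv 8%N isT; have := uv 9%N isT.
have := uv 10%N isT; move: E0 E1 E2.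
rewrite /addn /muln /=.
(* With the products as variables, a polynomial identity modulo [v k * u k = 1] remains. *)
move: (u 1%N) (u 2%N) (u 3%N) (u 4%N) (u 5%N) (u 6%N) (u 7%N) (u 8%N) (u 9%N)
  (u 10%N) (v 1%N) (v 2%N) (v 3%N) (v 4%N) (v 5%N) (v 6%N) (v 7%N) (v 8%N)
  (v 9%N) (v 10%N).
move=> u1 u2 u3 u4 u5 u6 u7 u8 u9 u10 v1 v2 v3 v4 v5 v6 v7 v8 v9 v10.
move=> E0 E1 E2 w10 w9 w8 w7 w6 w5 w4 w3 w2 w1.
(* [x] and [y] cancel two of the five factors in [E2], which moves the denominator to
   [f * a2 * a3]. *)
have E3 : E * (x * y) * (u2 * u4 * u6 * u8 * u10) = E * (f * a2 * a3).
  rewrite -E2; transitivity (E * (f * a2 * a3) * (x * a1) * (y * a4)).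
    by ring.
  by rewrite xP yP !mulr1.
have V1 : v1 * v2 * v3 * v4 * v5 * v6 * v7 * v8 * v9 * v10 *
    (u1 * u2 * u3 * u4 * u5 * u6 * u7 * u8 * u9 * u10) = 1.
  by ring: w1 w2 w3 w4 w5 w6 w7 w8 w9 w10.
have V2 : v2 * v4 * v6 * v8 * v10 * (u2 * u4 * u6 * u8 * u10) = 1.
  by ring: w2 w4 w6 w8 w10.
transitivity (v1 * v2 * v3 * v4 * v5 * v6 * v7 * v8 * v9 * v10 *
  (v2 * v4 * v6 * v8 * v10) *
  (E * (u1 * u2 * u3 * u4 * u5 * u6 * u7 * u8 * u9 * u10) * (f * a2 * a3))).
  rewrite -[LHS]mul1r -[in LHS]V1 -[LHS]mul1r -[in LHS]V2.
  transitivity (v1 * v2 * v3 * v4 * v5 * v6 * v7 * v8 * v9 * v10 *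
    (v2 * v4 * v6 * v8 * v10) *
    (u1 * u2 * u3 * u4 * u5 * u6 * u7 * u8 * u9 * u10) *
    (E * (x * y) * (u2 * u4 * u6 * u8 * u10))); first by ring.
  by rewrite E3; ring.
(* With A', B' the thetas at q^2, the product (A^2 - q A B - q^2 B^2)(A' + c q^2 B') has six terms,
   which become the six products of the statement. *)
rewrite E0 E1.
by ring: w1 w2 w3 w4 w5 w6 w7 w8 w9 w10.
Qed.
End Dissection.

(** * Independence of coefficients from the truncation *)

Section PolynomialAgreement.
Variable R : comNzRingType.
Implicit Types (P Q : {poly R}) (F G : nat -> {poly R}).

Definition agree_upto i P Q := forall l, (l <= i)%N -> P`_l = Q`_l.

Lemma agree_uptoM i P P' Q Q' :
  agree_upto i P P' -> agree_upto i Q Q' -> agree_upto i (P * Q) (P' * Q').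
Proof.
move=> PP QQ l le_li; rewrite !coefM; apply: eq_bigr => j _.
by rewrite PP ?QQ //; have := ltn_ord j; lia.
Qed.

Lemma agree_upto_prod i F G M : (i < M)%N ->
  (forall k, (k <= i)%N -> agree_upto i (F k) (G k)) ->
  (forall k, (i < k)%N -> agree_upto i (F k) 1) ->
  agree_upto i (\prod_(k < M) F k) (\prod_(k < i.+1) G k).
Proof.
move=> lt_iM FG F1; rewrite -(subnKC lt_iM) big_split_ord /=.
rewrite -[X in agree_upto _ _ X]mulr1.
apply: agree_uptoM.
  apply: (big_ind2 (agree_upto i)) => //; first exact: agree_uptoM.
  by move=> k _; apply: FG; rewrite -ltnS.
apply: (big_ind (agree_upto i ^~ 1)) => // [P Q P1 Q1|k _].
  by rewrite -(mulr1 1); apply: agree_uptoM.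
by apply: F1; rewrite addSn ltnS leq_addr.
Qed.

(** Each coefficient of [poch] is defined with its own truncation; this allows one [M] for all of
    them, since the factors with k > i are 1 up to degree i. *)
Lemma poch_coef s a o M i : (0 < s)%N -> (i < M)%N ->
  poch s a o i = (\prod_(k < M) (1 - a *: 'X^(o + s * k)) : {poly R})`_i.
Proof.
move=> s_gt0 lt_iM; symmetry.
apply: (agree_upto_prod (F := fun k => 1 - a *: 'X^(o + s * k))
  (G := fun k => 1 - a *: 'X^(o + s * k)) lt_iM _ _ (leqnn i))
  => // k lt_ik l le_li.
rewrite coefB coefZ coefXn (_ : (l == _) = false) ?mulr0 ?subr0 //.
by apply/eqP; nia.
Qed.

Lemma coef_geom a m M l : (0 < m)%N ->
  (\sum_(j < M) a ^+ j *: 'X^(j * m) : {poly R})`_l =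
  if (m %| l)%N && (l %/ m < M)%N then a ^+ (l %/ m) else 0.
Proof.
move=> m_gt0; rewrite coef_sum.
case: ifP => [/andP[/divnK def_l lt_M]|nM].
  rewrite (bigD1 (Ordinal lt_M)) //= big1 => [|j].
    by rewrite def_l coefZ coefXn eqxx mulr1 addr0.
  rewrite -val_eqE /= => ne_j; rewrite coefZ coefXn -{1}def_l eqn_pmul2r //.
  by rewrite eq_sym (negPf ne_j) mulr0.
rewrite big1 // => j _; rewrite coefZ coefXn.
case: eqP => [def_l|]; last by rewrite mulr0.
by rewrite def_l dvdn_mull // mulnK // ltn_ord in nM.
Qed.

Lemma ipoch_coef s a o M i : (0 < s)%N -> (0 < o)%N -> (i < M)%N ->
  ipoch s a o i =
    (\prod_(k < M) \sum_(j < M) a ^+ j *: 'X^(j * (o + s * k)) : {poly R})`_i.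
Proof.
move=> s_gt0 o_gt0 lt_iM; symmetry.
apply: (agree_upto_prod
  (F := fun k => \sum_(j < M) a ^+ j *: 'X^(j * (o + s * k)))
  (G := fun k => \sum_(j < i.+1) a ^+ j *: 'X^(j * (o + s * k)))
  lt_iM _ _ (leqnn i)) => k lt_ik l le_li.
  rewrite !coef_geom; try lia.
  have le_div : (l %/ (o + s * k) <= i)%N by rewrite (leq_trans (leq_div _ _)).
  by rewrite ltnS le_div (leq_ltn_trans le_div).
rewrite coef_geom ?coef1; last by lia.
case: l le_li => [|l] le_li.
  by rewrite dvdn0 div0n expr0; case: (M) lt_iM.
by rewrite gtnNdvd //=; nia.
Qed.
End PolynomialAgreement.

(** * Evaluation of power series at a nilpotent element *)

Section Evaluation.
Variables (R A : comNzRingType) (iota : {rmorphism R -> A}) (N : nat).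
Hypothesis N_gt0 : (0 < N)%N.
Implicit Types (x : A) (f g : series R) (P : {poly R}).

Definition seval x f : A := \sum_(i < N) iota (f i) * x ^+ i.

Lemma eq_seval x f g :
  (forall i, (i < N)%N -> f i = g i) -> seval x f = seval x g.
Proof. by move=> fg; apply: eq_bigr => i _; rewrite fg. Qed.

Lemma seval_coef x P :
  x ^+ N = 0 -> seval x (fun i => P`_i) = (map_poly iota P).[x].
Proof.
move=> xN; rewrite (@horner_coef_wide _ (N + size P)); last first.
  by rewrite (leq_trans (size_poly _ _)) ?leq_addl.
rewrite big_split_ord /= [X in _ = _ + X]big1 ?addr0 => [|i _].
  by apply: eq_bigr => i _; rewrite coef_map.
by rewrite exprD xN mul0r mulr0.
Qed.

(** Below [N] the Cauchy product has the coefficients of the product of the truncated polynomials,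
    and evaluating polynomials is multiplicative. *)
Lemma seval_mul x f g :
  x ^+ N = 0 -> seval x (smul f g) = seval x f * seval x g.
Proof.
move=> xN.
have truncE h : seval x h = (map_poly iota (\poly_(i < N) h i)).[x].
  by rewrite -seval_coef //; apply: eq_seval => i lt_iN; rewrite coef_poly lt_iN.
rewrite (truncE f) (truncE g) -hornerM -rmorphM -seval_coef //.
apply: eq_seval => i lt_iN; rewrite coefM; apply: eq_bigr => j _.
have := ltn_ord j; rewrite ltnS !coef_poly => le_ji.
by rewrite !ifT //; lia.
Qed.

Lemma seval_poch x s a o : x ^+ N = 0 -> (0 < s)%N ->
  seval x (poch s a o) = npoch N (x ^+ s) (iota a * x ^+ o).
Proof.
move=> xN s_gt0.
rewrite (eq_seval _ (fun i => poch_coef (M := N) a o s_gt0)) seval_coef //.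
rewrite rmorph_prod horner_prod; apply: eq_bigr => k _.
by rewrite rmorphB rmorph1 /= map_polyZ map_polyXn !hornerE exprD exprM mulrA.
Qed.

(** Factor by factor, a geometric sum times [1 - y] is [1 - y ^+ N]; positivity of [o] makes [y]
    nilpotent. *)
Lemma seval_ipoch x s a o : x ^+ N = 0 -> (0 < s)%N -> (0 < o)%N ->
  seval x (ipoch s a o) * seval x (poch s a o) = 1.
Proof.
move=> xN s_gt0 o_gt0; rewrite seval_poch //.
rewrite (eq_seval _ (fun i => ipoch_coef (M := N) a s_gt0 o_gt0)) seval_coef //.
rewrite rmorph_prod horner_prod -big_split big1 //= => k _.
pose y := iota a * x ^+ (o + s * k).
have -> : (map_poly iota (\sum_(j < N) a ^+ j *: 'X^(j * (o + s * k)))).[x] =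
    \sum_(j < N) y ^+ j.
  rewrite rmorph_sum horner_sum; apply: eq_bigr => j _ /=.
  by rewrite map_polyZ map_polyXn !hornerE rmorphXn exprMn mulnC exprM.
have -> : iota a * x ^+ o * x ^+ s ^+ k = y by rewrite /y exprD exprM mulrA.
rewrite mulrC -opprB mulNr -subrX1 /y exprMn.
by rewrite (expr_nilM _ xN) ?addn_gt0 ?o_gt0 // mulr0 sub0r opprK.
Qed.

Lemma seval_one x : seval x (sone R) = 1.
Proof.
rewrite /seval -(prednK N_gt0) big_ord_recl big1 => [|i _].
  by rewrite rmorph1 mul1r addr0.
by rewrite rmorph0 mul0r.
Qed.

Lemma seval_qratio x s num den : x ^+ N = 0 ->
  seval x (qratio s num den) =
  \prod_(p <- num) seval x (poch s p.1 p.2) *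
  \prod_(p <- den) seval x (ipoch s p.1 p.2).
Proof.
move=> xN; rewrite /qratio seval_mul //; congr (_ * _);
  by apply: big_morph => [f g|]; [apply: seval_mul | apply: seval_one].
Qed.

Lemma seval_add x f g : seval x (sadd f g) = seval x f + seval x g.
Proof. by rewrite -big_split; apply: eq_bigr => i _; rewrite rmorphD mulrDl. Qed.

Lemma seval_opp x f : seval x (sopp f) = - seval x f.
Proof. by rewrite -sumrN; apply: eq_bigr => i _; rewrite rmorphN mulNr. Qed.

Lemma seval_scale x c f : seval x (sscale c f) = iota c * seval x f.
Proof. by rewrite big_distrr; apply: eq_bigr => i _; rewrite rmorphM -mulrA. Qed.

Lemma seval_sum x (I : finType) (F : I -> series R) :
  seval x (fun n => \sum_i F i n) = \sum_i seval x (F i).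
Proof.
rewrite exchange_big; apply: eq_bigr => n _.
by rewrite rmorph_sum big_distrl.
Qed.

Lemma seval_widen x f M : x ^+ N = 0 -> (N <= M)%N ->
  \sum_(i < M) iota (f i) * x ^+ i = seval x f.
Proof.
move=> xN le_NM; rewrite -(subnKC le_NM) big_split_ord /=.
by rewrite [X in _ + X]big1 ?addr0 // => i _; rewrite exprD xN mul0r mulr0.
Qed.

Lemma seval_shift x r f :
  x ^+ N = 0 -> seval x (sshift r f) = x ^+ r * seval x f.
Proof.
move=> xN; rewrite -(seval_widen _ xN (leq_addl r N)) big_split_ord /=.
rewrite big1 => [|i _]; last by rewrite /sshift leqNgt ltn_ord rmorph0 mul0r.
rewrite add0r big_distrr; apply: eq_bigr => i _ /=.
by rewrite /sshift leq_addr addKn exprD mulrCA.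
Qed.

Lemma seval_dilate x m f : x ^+ N = 0 -> (0 < m)%N ->
  seval x (sdilate m f) = seval (x ^+ m) f.
Proof.
move=> xN m_gt0; rewrite -(seval_widen _ xN (leq_pmulr N m_gt0)).
rewrite (big_residues _ (fun i => iota (sdilate m f i) * x ^+ i)).
rewrite (bigD1 (Ordinal m_gt0)) //= [X in _ + X]big1 ?addr0 => [|r].
  apply: eq_bigr => k _.
  by rewrite /sdilate addn0 dvdn_mulr // mulKn // exprM.
rewrite -val_eqE /= => r_neq0; rewrite big1 // => k _.
rewrite /sdilate dvdn_addr ?dvdn_mulr // gtnNdvd ?ltn_ord ?lt0n //.
by rewrite rmorph0 mul0r.
Qed.
End Evaluation.

(** * The quotient ring R[X]/(X^(n+1)) *)

Section TruncatedSeries.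
Variables (R : comNzRingType) (n : nat).
Local Notation h := ('X^(n.+1) : {poly R}).

Definition trunc_const : {rmorphism R -> {poly %/ h}} := in_qpoly h \o polyC.

Definition trunc_var : {poly %/ h} := in_qpoly h 'X.

Lemma trunc_var_nil : trunc_var ^+ n.+1 = 0.
Proof.
rewrite -rmorphXn; apply: val_inj; rewrite /= mk_monic_Xn.
by apply: Pdiv.RingMonic.rmodpp; apply: monicXn.
Qed.

(** The value of a series is the class of its truncation, which has degree at most [n] and so is its
    own representative. *)
Lemma seval_trunc_inj f g :
  seval trunc_const n.+1 trunc_var f = seval trunc_const n.+1 trunc_var g ->
  f n = g n.
Proof.
have coefE e : (seval trunc_const n.+1 trunc_var e : {poly R})`_n = e n.
  have -> : seval trunc_const n.+1 trunc_var e =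
      in_qpoly h (\poly_(i < n.+1) e i).
    rewrite poly_def rmorph_sum; apply: eq_bigr => i _.
    by rewrite -mul_polyC rmorphM rmorphXn.
  rewrite in_qpoly_small ?coef_poly ?ltnSn // mk_monic_Xn size_polyXn.
  by rewrite ltnS size_poly.
by move=> E; rewrite -coefE E coefE.
Qed.
End TruncatedSeries.

(** * Specialisation of z and its formal inverse *)

Section LaurentEvaluation.
Variables (R : comNzRingType) (z w : R).

Definition eval_w : {rmorphism {poly int} -> R} :=
  horner_morph (fun a => mulrC w (a%:~R)).

Definition eval_zw : {rmorphism ZW -> R} :=
  horner_morph (fun P => mulrC z (eval_w P)).

Lemma eval_zw_z : eval_zw zvar = z.
Proof. exact: horner_morphX. Qed.

Lemma eval_zw_w : eval_zw wvar = w.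
Proof. by rewrite [LHS]horner_morphC; apply: horner_morphX. Qed.

Lemma eval_zwE (P : ZW) :
  eval_zw P = \sum_(a < size P) \sum_(b < size P`_a)
    ((P`_a)`_b)%:~R * (w ^+ b * z ^+ a).
Proof.
rewrite [LHS](@horner_coef_wide _ (size P)) ?size_poly //.
apply: eq_bigr => a _; rewrite coef_map /= -/(eval_w _).
rewrite [X in X * _](@horner_coef_wide _ (size P`_a)) ?size_poly // big_distrl.
by apply: eq_bigr => b _; rewrite coef_map /= mulrA.
Qed.
End LaurentEvaluation.

(** * Finite support of M2 and its sum against powers of z *)

Definition M2_bound n : nat :=
  (size (M2gen n) + \sum_(a < size (M2gen n)) size ((M2gen n)`_a)%R)%N.

Lemma M2_index_bound n (a : 'I_(size (M2gen n))) (b : 'I_(size (M2gen n)`_a)) :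
  (`|(a%:Z - b%:Z)%R| <= M2_bound n)%N.
Proof.
have : (b <= \sum_(a < size (M2gen n)) size ((M2gen n)`_a)%R)%N.
  by rewrite (bigD1 a) //= (leq_trans (ltnW (ltn_ord b))) ?leq_addr.
by have := ltn_ord a; rewrite /M2_bound; lia.
Qed.

Lemma M2_out m n : (M2_bound n < `|m|)%N -> M2 m n = 0.
Proof.
move=> lt_m; rewrite /M2 big1 // => a _; rewrite big_pred0 // => b.
by apply/eqP => E; have := M2_index_bound b; rewrite E leqNgt lt_m.
Qed.

Lemma centered_index (a b B : nat) : (`|(a%:Z - b%:Z)%R| <= B)%N ->
  exists2 i, (i < (2 * B).+1)%N & i%:Z - B%:Z = a%:Z - b%:Z.
Proof. by move=> le_B; exists (a + B - b)%N; lia. Qed.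

Lemma M2_sum (F : fieldType) (z : F) n : z != 0 ->
  \sum_(i < (2 * M2_bound n).+1)
     (M2 (i%:Z - (M2_bound n)%:Z) n)%:~R * z ^ (i%:Z - (M2_bound n)%:Z) =
  eval_zw z z^-1 (M2gen n).
Proof.
move=> z_neq0; rewrite eval_zwE.
move: (M2_bound n) (@M2_index_bound n) => B bound_B.
under eq_bigr => i _.
  rewrite /M2 rmorph_sum big_distrl /=.
  under eq_bigr => a _ do rewrite rmorph_sum big_distrl /= big_mkcond /=.
over.
rewrite exchange_big; apply: eq_bigr => a _.
rewrite exchange_big; apply: eq_bigr => b _ /=.
have le_B := bound_B a b.
have [i0 lt_i0 i0E] := centered_index le_B.
(* The monomial z^a w^b counts for exactly one m, namely a - b, where z^m = z^a (1/z)^b. *)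
rewrite (bigD1 (Ordinal lt_i0)) //= i0E eqxx big1 ?addr0 => [|i].
  rewrite expfzDr // -exprz_inv.
  by rewrite [X in _ = _ * X]mulrC.
rewrite -val_eqE /= => ne_i; rewrite ifF //; apply/eqP => E.
by have [i0_i] := addIr _ (etrans i0E E); rewrite i0_i eqxx in ne_i.
Qed.

(** * The theorem in a truncated ring, and its coefficients *)

Lemma seval_M2gen (zeta : algC) (A : comNzRingType) (q : A) N
    (io : {rmorphism algC -> A}) (iozw : {rmorphism ZW -> A}) :
  5.-primitive_root zeta -> (0 < N)%N -> q ^+ N = 0 ->
  iozw zvar = io zeta -> iozw wvar = io zeta^-1 ->
  seval iozw N q M2gen = seval io N q (M2rhs zeta).
Proof.
move=> prim_zeta N_gt0 qN z_zeta w_zeta.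
have z5 : zeta ^+ 5 = 1 := prim_expr_order prim_zeta.
have z_neq0 : zeta != 0.
  by apply: contra_eq_neq z5 => ->; rewrite expr0n eq_sym oner_neq0.
have z_pow k : (0 < k < 5)%N -> 1 - zeta ^+ k != 0.
  move=> /andP[k_gt0 lt_k5]; rewrite subr_eq0 eq_sym -(prim_order_dvd prim_zeta).
  by rewrite gtnNdvd.
have z_sum : zeta ^+ 4 + zeta ^+ 3 + zeta ^+ 2 + zeta + 1 = 0.
  apply: (mulfI (z_pow 1%N isT)); rewrite mulr0 expr1.
  transitivity (1 - zeta ^+ 5); first by ring.
  by rewrite z5 subrr.
have zV : zeta^-1 = zeta ^+ 4.
  by apply: (mulfI z_neq0); rewrite mulfV // -exprS z5.
have q5N : (q ^+ 5) ^+ N = 0 by apply: expr_nilM.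
have nqN : (- q) ^+ N = 0 by rewrite exprNn qN mulr0.
(* Nonzero elements of the field [algC] become units, which supplies the invertibility of 1 - t and
   1 - t^2. *)
have inv_io x : x != 0 -> invertible (io x).
  by move=> x0; exists (io x^-1); rewrite -rmorphM mulVf ?rmorph1.
have inv_t := inv_io _ (z_pow 1%N isT).
have inv_t2 := inv_io _ (z_pow 2%N isT).
have t_sum := congr1 io z_sum.
rewrite rmorphB rmorph1 expr1 in inv_t.
rewrite rmorphB rmorph1 rmorphXn in inv_t2.
rewrite !rmorphD !rmorphXn rmorph1 rmorph0 in t_sum.
(* The sign of [(- q) ^+ (5 * k)] is that of [(-1) ^+ k], while 50 is even: this matches the
   theorem, where odd offsets carry -1 and even ones 1. *)
have uE k : seval io N (q ^+ 5) (poch 10 ((-1) ^+ k) k) = npoch50 N (- q) k.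
  rewrite seval_poch // /npoch50 -!exprM rmorphXn rmorphN1.
  rewrite [in RHS]exprNn -(signr_odd _ 50) mul1r [in RHS]exprNn.
  by rewrite -(signr_odd _ (5 * k)) oddM andTb signr_odd.
pose v (k : nat) := seval io N (q ^+ 5) (ipoch 10 ((-1) ^+ k) k).
have uv k : (0 < k)%N -> v k * npoch50 N (- q) k = 1.
  by move=> k_gt0; rewrite -uE; apply: seval_ipoch.
have xP : seval iozw N q (ipoch 2 zvar 2) *
    npoch N ((- q) ^+ 2) (io zeta * (- q) ^+ 2) = 1.
  by rewrite sqrrN -z_zeta -seval_poch // seval_ipoch.
have yP : seval iozw N q (ipoch 2 wvar 2) *
    npoch N ((- q) ^+ 2) (io zeta ^+ 4 * (- q) ^+ 2) = 1.
  by rewrite sqrrN -rmorphXn -zV -w_zeta -seval_poch // seval_ipoch.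
rewrite /M2gen !seval_mul //.
have -> : seval iozw N q (poch 2 (-1) 1) = npoch N ((- q) ^+ 2) (- q).
  by rewrite seval_poch // sqrrN rmorphN1 mulN1r expr1.
have -> : seval iozw N q (poch 2 1 2) = npoch N ((- q) ^+ 2) ((- q) ^+ 2).
  by rewrite seval_poch // sqrrN rmorph1 mul1r.
rewrite (crank_dissection nqN t_sum inv_t inv_t2 xP yP uv).
rewrite /M2rhs seval_sum.
under [RHS]eq_bigr => r _ do rewrite seval_shift // seval_dilate //.
rewrite !big_ord_recl big_ord0 /= addr0.
rewrite seval_opp !seval_scale seval_add seval_opp seval_scale.
rewrite !seval_qratio // !big_cons !big_nil /=.
have u_odd k : odd k -> seval io N (q ^+ 5) (poch 10 (-1) k) = npoch50 N (- q) k.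
  by move=> odd_k; rewrite -uE -signr_odd odd_k.
have u_even k : ~~ odd k -> seval io N (q ^+ 5) (poch 10 1 k) = npoch50 N (- q) k.
  by move=> /negPf even_k; rewrite -uE -signr_odd even_k.
have v_odd k : odd k -> seval io N (q ^+ 5) (ipoch 10 (-1) k) = v k.
  by move=> odd_k; rewrite /v -[(-1) ^+ k]signr_odd odd_k.
have v_even k : ~~ odd k -> seval io N (q ^+ 5) (ipoch 10 1 k) = v k.
  by move=> /negPf even_k; rewrite /v -[(-1) ^+ k]signr_odd even_k.
rewrite !u_odd // !u_even // !v_odd // !v_even //.
rewrite !rmorphD !rmorphXn.
(* The powers of [- q] restore the signs of the odd components. *)
by ring.
Qed.

Unset Implicit Arguments.
Set Strict Implicit.

Theorem theorem2p12 (zeta : algC) (hz : 5.-primitive_root zeta) (n : nat) :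
  exists N0 : nat,
    (forall m : int, (N0 < `|m|)%N -> M2 m n = 0) /\
    \sum_(i < (2 * N0).+1)
       (M2 (i%:Z - N0%:Z) n)%:~R * zeta ^ (i%:Z - N0%:Z)
    = M2rhs zeta n.
Proof.
exists (M2_bound n); split=> [m|]; first exact: M2_out.
have z_neq0 : zeta != 0.
  apply: contra_eq_neq (prim_expr_order hz) => ->.
  by rewrite expr0n eq_sym oner_neq0.
rewrite M2_sum //.
(* Specialising z and w first makes evaluation of [M2gen] at [iozw] the evaluation of a series over
   [algC], whose coefficient [n] can be read off. *)
pose iozw : {rmorphism ZW -> _} := trunc_const algC n \o eval_zw zeta zeta^-1.
apply: (seval_trunc_inj (f := fun i => eval_zw zeta zeta^-1 (M2gen i))).
apply: (seval_M2gen (iozw := iozw) hz) => //.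
- exact: trunc_var_nil.
- by rewrite /iozw /= eval_zw_z.
- by rewrite /iozw /= eval_zw_w.
Qed.
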